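(* Let $(M,g)$ be a Riemannian manifold, let $\psi\in\mathrm{Aut}(TM)$ be a $g$-Codazzi map, and let $h:=g^\psi=g(\psi^{-1}\cdot,\psi^{-1}\cdot)$. Then the curvature operators on $2$-forms of $h$ and $g$ satisfy $$\mathcal{R}^h=\mathcal{R}^g\circ\psi^\ast,$$ where $\psi^\ast:\wedge^2T^\ast M\to\wedge^2T^\ast M$ is the pullback $\psi^\ast\beta:=\beta(\psi\cdot,\psi\cdot)$.
   Context: $\mathrm{Aut}(TM)$ denotes the smooth vector bundle automorphisms of $TM$ covering the identity of $M$. With $\nabla^g$ the Levi-Civita connection of $g$, a $g$-Codazzi map is an element $\psi\in\mathrm{Aut}(TM)$ such that $(\nabla^g_X\psi^{-1})Y=(\nabla^g_Y\psi^{-1})X$ for all vector fields $X,Y$, where $(\nabla^g_X\psi^{-1})Y:=\nabla^g_X(\psi^{-1}Y)-\psi^{-1}(\nabla^g_XY)$. For any Riemannian metric $g$: $R^g(X,Y)Z:=\nabla^g_X\nabla^g_YZ-\nabla^g_Y\nabla^g_XZ-\nabla^g_{[X,Y]}Z$ and $\mathrm{Rm}^g(X,Y,Z,W):=g(R^g(X,Y)Z,W)$. By its symmetries, $\mathrm{Rm}^g$ is regarded as a symmetric bilinear form on $\wedge^2TM$ via $\mathrm{Rm}^g(X\wedge Y,Z\wedge W):=\mathrm{Rm}^g(X,Y,Z,W)$. The musical isomorphism $\sharp_g:T^\ast M\to TM$ is extended to $\wedge^2T^\ast M\to\wedge^2TM$ by acting on each factor of the wedge product. The curvature operator on $2$-forms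 $\mathcal{R}^g:\wedge^2T^\ast M\to\wedge^2T^\ast M$ is defined by $$(\mathcal{R}^g(\gamma))(X,Y):=-\mathrm{Rm}^g(X\wedge Y,\gamma^{\sharp_g}).$$ The operator $\mathcal{R}^h$ is defined in the same way from the metric $h$. *)

(* Defs.v *)
From HB Require Import structures.
From mathcomp Require Import all_boot all_order all_algebra.
From mathcomp Require Import all_classical all_reals all_analysis.
From mathcomp Require Import ring.
Import Order.TTheory GRing.Theory Num.Theory numFieldNormedType.Exports.

Set Implicit Arguments.
Unset Strict Implicit.
Unset Printing Implicit Defensive.

Local Open Scope classical_set_scope.
Local Open Scope ring_scope.

Lemma zerofctE (T : Type) (V : nmodType) (x : T) : (0 : T -> V) x = 0.
Proof. by []. Qed.

Section SmoothEuclidean.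
Variables (R : realType) (n : nat).
Implicit Types (U : set 'rV[R]_n) (f g : 'rV[R]_n -> R).

(* For open U: the partial derivatives of f up to order k exist and are
   continuous on U. Total differentiability is asked for because the existence
   of the partial derivatives alone does not give it; for k >= 1 it is implied
   by their continuity, so this is the usual class C^k. *)
Fixpoint Ck (k : nat) U f : Prop :=
  if k is k'.+1 then
    (forall x, U x -> differentiable f x) /\
    (forall i : 'I_n, Ck k' U ('D_(delta_mx 0 i) f))
  else forall x, U x -> {for x, continuous f}.

Definition Cinfty U f : Prop := forall k, Ck k U f.

Lemma near0_differentiable f x : (\near x, f x = 0) -> differentiable f x.
Proof.
move=> f0; have fx : f x = 0 by exact: nbhs_singleton f0.
have c0 : continuous (\0 : 'rV[R]_n -> R) by move=> y; exact: cst_continuous.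
have H : f \o shift x = cst (f x) + (\0 : 'rV[R]_n -> R) +o_ 0 id.
  apply/eqaddoP => e e0 /=; rewrite fx.
  move: f0; rewrite (near_shift 0)/= subr0 => f0.
  near=> h; have -> : (f \o shift x - (cst 0 + 0)) h = f (h + x) - (0 + 0) by [].
  have -> : f (h + x) = 0 by near: h; exact: f0.
  by rewrite addr0 subr0 normr0 mulr_ge0// ltW.
have d0 := @diff_unique _ _ _ f (\0 : {linear 'rV[R]_n -> R}) x c0 H.
by apply/diff_locallyP; rewrite d0; split.
Unshelve. all: by end_near. Qed.

Lemma near_eq_differentiable f g x :
  (\near x, f x = g x) -> differentiable f x -> differentiable g x.
Proof.
move=> fg df; have -> : g = f + (g - f) by rewrite addrC subrK.
apply: differentiableD => //; apply: near0_differentiable.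
by apply: filterS fg => y fgy; rewrite !fctE fgy subrr.
Qed.

Lemma open_eq_near U f g x : open U -> (forall y, U y -> f y = g y) -> U x ->
  \near x, f x = g x.
Proof.
move=> oU fg Ux; have Unbhs : nbhs x U by exact: open_nbhs_nbhs.
by apply: filterS Unbhs => y; exact: fg.
Qed.

Lemma eq_Ck k U f g : open U -> (forall x, U x -> f x = g x) ->
  Ck k U f -> Ck k U g.
Proof.
move=> oU; elim: k f g => [|k IHk] f g fg /=.
  move=> cf x Ux; rewrite /prop_for /continuous_at -(fg x Ux).
  have fgx := open_eq_near oU fg Ux.
  exact: cvg_trans (near_eq_cvg fgx) (cf x Ux).
move=> [df Df]; split=> [x Ux|i].
  exact: near_eq_differentiable (open_eq_near oU fg Ux) (df x Ux).
apply: IHk (Df i) => x Ux; apply: near_eq_derive.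
exact: open_eq_near oU fg Ux.
Qed.

Lemma Ck_le k U f : Ck k.+1 U f -> Ck k U f.
Proof.
elim: k f => [|k IHk] f [df Df].
  by move=> x Ux; exact/differentiable_continuous/df.
by split=> // i; exact: IHk.
Qed.

Lemma Ck_cst k U (c : R) : Ck k U (cst c).
Proof.
elim: k c => [|k IHk] c /=; first by move=> x _; exact: cst_continuous.
split=> [x _|i]; first exact: differentiable_cst.
suff -> : 'D_(delta_mx 0 i) (cst c) = cst 0 :> ('rV[R]_n -> R) by [].
by apply/funext => x; rewrite derive_cst.
Qed.

Lemma Ck_add k U f g : open U -> Ck k U f -> Ck k U g -> Ck k U (f + g).
Proof.
move=> oU; elim: k f g => [|k IHk] f g /=.
  by move=> cf cg x Ux; apply: continuousD; [exact: cf|exact: cg].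
move=> [df Df] [dg Dg]; split=> [x Ux|i].
  by apply: differentiableD; [exact: df|exact: dg].
apply: eq_Ck oU _ (IHk _ _ (Df i) (Dg i)) => x Ux.
by rewrite deriveD//; apply: diff_derivable; [exact: df|exact: dg].
Qed.

Lemma Ck_mul k U f g : open U -> Ck k U f -> Ck k U g -> Ck k U (f * g).
Proof.
move=> oU; elim: k f g => [|k IHk] f g.
  by move=> cf cg x Ux; apply: continuousM; [exact: cf|exact: cg].
move=> cf cg; have [df Df] := cf; have [dg Dg] := cg.
split=> [x Ux|i].
  by apply: differentiableM; [exact: df|exact: dg].
apply: eq_Ck oU _ (Ck_add oU (IHk _ _ (Ck_le cf) (Dg i))
                             (IHk _ _ (Ck_le cg) (Df i))) => x Ux.
by rewrite deriveM//; apply: diff_derivable; [exact: df|exact: dg].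
Qed.

End SmoothEuclidean.

Record chart (R : realType) (n : nat) (M : topologicalType) := Chart {
  chart_dom : set M;
  chart_map : M -> 'rV[R]_n;
  chart_inv : 'rV[R]_n -> M;
  chart_dom_open : open chart_dom;
  chart_img_open : open (chart_map @` chart_dom);
  chart_mapK : forall p, chart_dom p -> chart_inv (chart_map p) = p;
  chart_map_cont : {in chart_dom, continuous chart_map};
  chart_inv_cont : {in chart_map @` chart_dom, continuous chart_inv}
}.

Record manifold (R : realType) (n : nat) := Manifold {
  mcarrier :> topologicalType;
  atlas : set (chart R n mcarrier);
  mhausdorff : hausdorff_space mcarrier;
  msecond_countable : @second_countable mcarrier;
  atlas_cover : forall p, exists2 c, atlas c & chart_dom c p;
  atlas_compat : forall c d, atlas c -> atlas d -> forall i : 'I_n,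
    Cinfty (chart_map c @` (chart_dom c `&` chart_dom d))
      (fun x => chart_map d (chart_inv c x) 0 i)
}.

Section Manifold.
Variables (R : realType) (n : nat) (M : manifold R n).

Definition smooth (f : M -> R) : Prop := forall c, atlas c ->
  Cinfty (chart_map c @` chart_dom c) (f \o chart_inv c).

Lemma smooth_cst (a : R) : smooth (cst a).
Proof. by move=> c _ k; exact: Ck_cst. Qed.

Lemma smooth_add f g : smooth f -> smooth g -> smooth (f + g).
Proof.
by move=> sf sg c ac k; apply: Ck_add; [exact: chart_img_open|exact: sf|exact: sg].
Qed.

Lemma smooth_mul f g : smooth f -> smooth g -> smooth (f * g).
Proof.
by move=> sf sg c ac k; apply: Ck_mul; [exact: chart_img_open|exact: sf|exact: sg].
Qed.

Lemma smooth_scale a f : smooth f -> smooth (a *: f).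
Proof. by move=> sf; exact: smooth_mul (smooth_cst a) sf. Qed.

Definition smooth_pred : {pred M -> R} := fun f => `[< smooth f >].

Lemma smooth_pred_subring : subring_closed smooth_pred.
Proof.
split=> [|f g /asboolP sf /asboolP sg|f g /asboolP sf /asboolP sg]; apply/asboolP.
- exact: smooth_cst.
- by rewrite -scaleN1r; apply: smooth_add => //; exact: smooth_scale.
- exact: smooth_mul.
Qed.

Lemma smooth_pred_scaler : GRing.scaler_closed smooth_pred.
Proof. by move=> a f /asboolP sf; apply/asboolP; exact: smooth_scale. Qed.

HB.instance Definition _ := GRing.isSubringClosed.Build (M -> R) smooth_pred
  smooth_pred_subring.
HB.instance Definition _ := GRing.isScaleClosed.Build R (M -> R) smooth_pred
  smooth_pred_scaler.

Record smoothFun := SmoothFun {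
  smooth_fun :> M -> R;
  smooth_funP : smooth_pred smooth_fun
}.
HB.instance Definition _ := [isSub for smooth_fun].
HB.instance Definition _ := [Choice of smoothFun by <:].
HB.instance Definition _ := 
  GRing.SubChoice_isSubComPzRing.Build (M -> R) smooth_pred smoothFun
    smooth_pred_subring.
HB.instance Definition _ := [SubZmodule_isSubLmodule of smoothFun by <:].

Lemma smoothFun_smooth (f : smoothFun) : smooth f.
Proof. by have /asboolP := smooth_funP f. Qed.

Definition mkSmooth (f : M -> R) (sf : smooth f) : smoothFun :=
  SmoothFun (asboolT sf).

Definition is_tangent (p : M) (v : smoothFun -> R) : Prop :=
  linear_for *%R v /\ forall f g, v (f * g) = f p * v g + g p * v f.

Definition tangent_pred (p : M) : {pred smoothFun -> R} :=
  fun v => `[< is_tangent p v >].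

Lemma tangent_pred_submod p : submod_closed (tangent_pred p).
Proof.
split=> [|a u v /asboolP[lu du] /asboolP[lv dv]]; apply/asboolP; split.
- by move=> a f g; rewrite !zerofctE mulr0 addr0.
- by move=> f g; rewrite !zerofctE !mulr0 addr0.
- move=> b f g; rewrite !fctE lu lv /GRing.scale/= !mulrDr mulrCA.
  by rewrite -!addrA; congr (_ + _); rewrite addrCA.
- move=> f g; rewrite !fctE du dv /GRing.scale/= !mulrDr (mulrCA a) (mulrCA a).
  by rewrite -!addrA; congr (_ + _); rewrite addrCA.
Qed.

HB.instance Definition _ p := GRing.isSubmodClosed.Build R (smoothFun -> R)
  (tangent_pred p) (tangent_pred_submod p).

(* T_pM as the space of derivations at p of C^oo(M). *)
Record tangent (p : M) := Tangent {
  tangent_fun :> smoothFun -> R;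
  tangentP : tangent_pred p tangent_fun
}.
HB.instance Definition _ p := [isSub for @tangent_fun p].
HB.instance Definition _ p := [Choice of tangent p by <:].
HB.instance Definition _ p := [SubChoice_isSubLmodule of tangent p by <:].

Definition is_vfield (X : smoothFun -> smoothFun) : Prop :=
  (forall (a : R) f g, X (a *: f + g) = a *: X f + X g) /\
  (forall f g, X (f * g) = f * X g + g * X f).

Definition vfield_pred : {pred smoothFun -> smoothFun^o} :=
  fun X => `[< is_vfield X >].

Lemma smoothFun_scaleE (h f : smoothFun) : (h *: (f : smoothFun^o)) = h * f.
Proof. by []. Qed.

Lemma scale_mul_smooth (a : R) (f g : smoothFun) : f * (a *: g) = a *: (f * g).
Proof. by apply/val_inj/funext => p /=; rewrite !fctE /GRing.scale/= mulrCA. Qed.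

Lemma vfield_pred_submod : submod_closed vfield_pred.
Proof.
split=> [|h X Y /asboolP[lX dX] /asboolP[lY dY]]; apply/asboolP; split.
- by move=> a f g; rewrite !zerofctE scaler0 addr0.
- by move=> f g; rewrite !zerofctE !mulr0 addr0.
- move=> b f g; rewrite !fctE !smoothFun_scaleE lX lY mulrDr scale_mul_smooth.
  by rewrite scalerDr addrACA.
- move=> f g; rewrite !fctE !smoothFun_scaleE dX dY !mulrDr.
  by rewrite (mulrCA h f) (mulrCA h g) addrACA.
Qed.

HB.instance Definition _ := GRing.isSubmodClosed.Build smoothFun
  (smoothFun -> smoothFun^o) vfield_pred vfield_pred_submod.

(* Gamma(TM): a smooth section X of TM is the same datum as the derivation
   f |-> (p |-> X_p f) of C^oo(M); [vf_at] recovers the section. *)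
Record vfield := VField {
  vf_fun :> smoothFun -> smoothFun^o;
  vfieldP : vfield_pred vf_fun
}.
HB.instance Definition _ := [isSub for vf_fun].
HB.instance Definition _ := [Choice of vfield by <:].
HB.instance Definition _ := [SubChoice_isSubLmodule of vfield by <:].

Lemma vfield_is (X : vfield) : is_vfield X.
Proof. by have /asboolP := vfieldP X. Qed.

Lemma vf_at_subproof (X : vfield) p : tangent_pred p (fun f => (X f : smoothFun) p).
Proof.
have [lX dX] := vfield_is X.
by apply/asboolP; split=> [a f g|f g]; rewrite ?lX ?dX.
Qed.

Definition vf_at (X : vfield) p : tangent p := Tangent (vf_at_subproof X p).

Lemma bracket_subproof (X Y : vfield) :
  vfield_pred (fun f => X (Y f) - Y (X f)).
Proof.
have [lX dX] := vfield_is X; have [lY dY] := vfield_is Y.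
have XD f g : X (f + g) = X f + X g by have := lX 1 f g; rewrite !scale1r.
have YD f g : Y (f + g) = Y f + Y g by have := lY 1 f g; rewrite !scale1r.
apply/asboolP; split=> [a f g|f g].
  by rewrite !(lX, lY) scalerBr opprD addrACA.
rewrite !(dX, dY, XD, YD) !mulrBr.
by apply/val_inj/funext => p /=; rewrite !fctE /=; ring.
Qed.

Definition bracket (X Y : vfield) : vfield := VField (bracket_subproof X Y).

Record metric := Metric {
  metric_at :> forall p, tangent p -> tangent p -> R;
  metric_linear : forall p v, linear_for *%R (@metric_at p ^~ v);
  metric_sym : forall p (u v : tangent p), metric_at u v = metric_at v u;
  metric_pos : forall p (u : tangent p), u != 0 -> 0 < metric_at u u;
  metric_smooth : forall X Y : vfield,
    smooth (fun p => metric_at (vf_at X p) (vf_at Y p))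
}.

Definition metric_vf (g : metric) (X Y : vfield) : smoothFun :=
  mkSmooth (metric_smooth g X Y).

(* Smooth bundle endomorphisms of TM covering the identity of M; smoothness is
   tested on smooth sections. *)
Record bundle_map := BundleMap {
  bm_at :> forall p, {linear tangent p -> tangent p};
  bm_smooth : forall (X : vfield) (f : smoothFun),
    smooth (fun p => bm_at p (vf_at X p) f)
}.

Lemma bm_vf_subproof (phi : bundle_map) (X : vfield) :
  vfield_pred (fun f => mkSmooth (bm_smooth phi X f)).
Proof.
apply/asboolP; split=> [a f g|f g]; apply/val_inj/funext => p /=;
  have /asboolP[l d] := tangentP (phi p (vf_at X p)).
- by rewrite l.
- by rewrite d.
Qed.

Definition bm_vf (phi : bundle_map) (X : vfield) : vfield :=
  VField (bm_vf_subproof phi X).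

Record bundle_aut := BundleAut {
  aut_map :> bundle_map;
  aut_inv : bundle_map;
  aut_mapK : forall p, cancel (aut_map p) (aut_inv p);
  aut_invK : forall p, cancel (aut_inv p) (aut_map p)
}.

Section PullMetric.
Variables (g : metric) (psi : bundle_aut).

Let h p (u v : tangent p) : R := g p (aut_inv psi p u) (aut_inv psi p v).

Lemma pull_metric_linear p v : linear_for *%R (@h p ^~ v).
Proof. by move=> a u u'; rewrite /h linearP metric_linear. Qed.

Lemma pull_metric_sym p (u v : tangent p) : h u v = h v u.
Proof. exact: metric_sym. Qed.

Lemma pull_metric_pos p (u : tangent p) : u != 0 -> 0 < h u u.
Proof.
move=> u0; apply: metric_pos; apply: contra_neq u0 => /(congr1 (psi p)).
by rewrite aut_invK linear0.
Qed.

Lemma bm_vf_at (phi : bundle_map) X p : vf_at (bm_vf phi X) p = phi p (vf_at X p).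
Proof. by apply/val_inj/funext. Qed.

Lemma pull_metric_smooth X Y : smooth (fun p => h (vf_at X p) (vf_at Y p)).
Proof.
have := metric_smooth g (bm_vf (aut_inv psi) X) (bm_vf (aut_inv psi) Y).
by congr smooth; apply/funext => p; rewrite !bm_vf_at.
Qed.

Definition pull_metric : metric := Metric pull_metric_linear pull_metric_sym
  pull_metric_pos pull_metric_smooth.

End PullMetric.

Definition connection := vfield -> vfield -> vfield.

Record is_levi_civita (g : metric) (nab : connection) : Prop := IsLeviCivita {
  lc_linearl : forall (f : smoothFun) (X Y Z : vfield),
    nab (f *: X + Y) Z = f *: nab X Z + nab Y Z;
  lc_addr : forall X Y Z : vfield, nab X (Y + Z) = nab X Y + nab X Z;
  lc_leibniz : forall (f : smoothFun) (X Y : vfield),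
    nab X (f *: Y) = X f *: Y + f *: nab X Y;
  lc_metric : forall X Y Z : vfield,
    X (metric_vf g Y Z) = metric_vf g (nab X Y) Z + metric_vf g Y (nab X Z);
  lc_torsion : forall X Y : vfield, nab X Y - nab Y X = bracket X Y
}.

Definition nab_bm (nab : connection) (phi : bundle_map) (X Y : vfield) : vfield :=
  nab X (bm_vf phi Y) - bm_vf phi (nab X Y).

Definition is_codazzi (nab : connection) (psi : bundle_aut) : Prop :=
  forall X Y, nab_bm nab (aut_inv psi) X Y = nab_bm nab (aut_inv psi) Y X.

Definition curvature (nab : connection) (X Y Z : vfield) : vfield :=
  nab X (nab Y Z) - nab Y (nab X Z) - nab (bracket X Y) Z.

Definition Rm (g : metric) (nab : connection) (X Y Z W : vfield) : smoothFun :=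
  metric_vf g (curvature nab X Y Z) W.

End Manifold.

Record alt2 (R : pzRingType) (V : lmodType R) := Alt2 {
  alt2_fun :> V -> V -> R;
  alt2_linearl : forall v, linear_for *%R (alt2_fun ^~ v);
  alt2_linearr : forall u, linear_for *%R (alt2_fun u);
  alt2_alt : forall u, alt2_fun u u = 0
}.

Lemma alt2_pull_linearl (R : pzRingType) (V : lmodType R)
  (phi : {linear V -> V}) (b : alt2 V) v :
  linear_for *%R (fun u => b (phi u) (phi v)).
Proof. by move=> a u u'; rewrite linearP alt2_linearl. Qed.

Lemma alt2_pull_linearr (R : pzRingType) (V : lmodType R)
  (phi : {linear V -> V}) (b : alt2 V) u :
  linear_for *%R (fun v => b (phi u) (phi v)).
Proof. by move=> a v v'; rewrite linearP alt2_linearr. Qed.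

Definition alt2_pull (R : pzRingType) (V : lmodType R)
    (phi : {linear V -> V}) (b : alt2 V) : alt2 V :=
  Alt2 (alt2_pull_linearl phi b) (alt2_pull_linearr phi b)
    (fun u => alt2_alt b (phi u)).

(* The exterior square of V is realized as the span of the evaluations
   b |-> b u v in the dual of the space of alternating forms. *)
Definition wedge (R : pzRingType) (V : lmodType R) (u v : V) : alt2 V -> R :=
  fun b => b u v.

(* 2-forms are identified with alternating bilinear forms by
   (a /\ b)(u, v) = a u * b v - a v * b u. *)
Definition cowedge (R : pzRingType) (V : lmodType R) (a b : {scalar V}) :
    V -> V -> R :=
  fun u v => a u * b v - a v * b u.

Section CurvatureOperator.
Variables (R : realType) (n : nat) (M : manifold R n).
Variables (g : metric M) (nab : connection M).

Definition is_sharp p (a : {scalar tangent p}) (v : tangent p) : Prop :=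
  forall w, g p v w = a w.

(* (\sum_i a_i /\ b_i)^sharp = \sum_i a_i^sharp /\ b_i^sharp; as T_pM is
   finite-dimensional, such a decomposition of gamma exists, and u does not
   depend on it. *)
Definition sharp2 p (gamma : alt2 (tangent p)) : alt2 (tangent p) -> R :=
  xget 0 [set u | exists k (a b : 'I_k -> {scalar tangent p})
                           (v w : 'I_k -> tangent p),
    [/\ forall i, is_sharp (a i) (v i) /\ is_sharp (b i) (w i),
        forall x y, gamma x y = \sum_(i < k) cowedge (a i) (b i) x y &
        u = \sum_(i < k) wedge (v i) (w i)]].

(* The bilinear form on the exterior square of T_pM with
   Rm(X /\ Y, Z /\ W) = Rm(X, Y, Z, W): tangent vectors at p extend to smooth
   vector fields, and by tensoriality and the symmetries of Rm the value r depends
   neither on the extensions nor on the decompositions of u and v. *)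
Definition Rm2 p (u v : alt2 (tangent p) -> R) : R :=
  xget 0 [set r | exists k l (X Y : 'I_k -> vfield M) (Z W : 'I_l -> vfield M),
    [/\ u = \sum_(i < k) wedge (vf_at (X i) p) (vf_at (Y i) p),
        v = \sum_(j < l) wedge (vf_at (Z j) p) (vf_at (W j) p) &
        r = \sum_(i < k) \sum_(j < l) Rm g nab (X i) (Y i) (Z j) (W j) p]].

Definition curvature_operator p (gamma : alt2 (tangent p)) :
    tangent p -> tangent p -> R :=
  fun x y => - Rm2 (wedge x y) (sharp2 gamma).

End CurvatureOperator.

(* Main.v *)
Require Import Defs.
From mathcomp Require Import all_boot all_order all_algebra.
From mathcomp Require Import all_classical all_reals all_analysis.
From mathcomp Require Import lra.
Import Order.TTheory GRing.Theory Num.Theory.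

Set Implicit Arguments.
Unset Strict Implicit.
Unset Printing Implicit Defensive.

Local Open Scope classical_set_scope.
Local Open Scope ring_scope.

(** Fibrewise, everything is transported by psi. The Codazzi equation says that
the connection nab' X Y := psi (nab^g X (psi^-1 Y)) has no torsion, because
psi (nab^g_X (psi^-1 Y)) - psi (nab^g_Y (psi^-1 X)) = nab^g_X Y - nab^g_Y X, and
nab' preserves h because psi is an isometry from g to h. Hence nab' is the
Levi-Civita connection of h ([levi_civita_conj], [levi_civita_uniq]). Conjugating
a connection by psi conjugates its curvature endomorphism, whence
Rm^h(X, Y, Z, W) = Rm^g(X, Y, psi^-1 Z, psi^-1 W) ([Rm_conj]). On the other hand
an h-sharp is psi of the g-sharp of the pulled back form, so the bivector
sharp_g (psi^* gamma) is the image under psi^-1 of the bivector sharp_h gamma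
([sharp2_pull]). The two occurrences of psi^-1 match, which is the theorem.

The bilinear extension of Rm and the sharp of a 2-form are both the canonical
choice of an element in a set of admissible values. For Rm nothing has to be
known about that set: the sets attached to h and to g are equal ([Rm2_conj]). For
the sharps the sets are only in bijection through psi^-1, and a choice commutes
with a bijection only when the sets have at most one element. So it has to be
proved that the sharp of a 2-form does not depend on its decomposition
([sharp2_spec_uniq]); this is linear algebra in the span of the finitely many
vectors involved, on which the inner product provides a reproducing frame
([dual_frame]). *)

(** * Linear and alternating forms *)

Lemma linear_formD (R : pzRingType) (V : lmodType R) (f : V -> R) :
  linear_for *%R f -> {morph f : x y / x + y}.
Proof. by move=> lf x y; rewrite -[x in LHS]scale1r lf mul1r. Qed.

Lemma linear_form0 (R : pzRingType) (V : lmodType R) (f : V -> R) :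
  linear_for *%R f -> f 0 = 0.
Proof. by move=> lf; apply: (addrI (f 0)); rewrite -linear_formD// !addr0. Qed.

Lemma linear_formB (R : pzRingType) (V : lmodType R) (f : V -> R) :
  linear_for *%R f -> {morph f : x y / x - y}.
Proof.
by move=> lf x y; rewrite addrC -scaleN1r lf mulN1r addrC.
Qed.

Lemma linear_form_sum (R : pzRingType) (V : lmodType R) (f : V -> R)
    (I : finType) (c : I -> R) (F : I -> V) :
  linear_for *%R f -> f (\sum_i c i *: F i) = \sum_i c i * f (F i).
Proof.
move=> lf; rewrite (big_morph f (linear_formD lf) (linear_form0 lf)).
by apply: eq_bigr => i _; rewrite -[c i *: _]addr0 lf linear_form0 ?addr0.
Qed.

(** For linearly dependent vectors the Gram matrix A is singular, but any
generalized inverse P of it still gives a frame f_k := \sum_l P k l s_l: as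
A P A = A, the difference of the two sides for v = s_i is orthogonal to every
s_j, and it lies in their span, so positivity makes it vanish. *)
Lemma dual_frame (R : realFieldType) (V : lmodType R) (G : V -> V -> R)
    (Gl : forall v, linear_for *%R (G ^~ v)) (Gs : forall u v, G u v = G v u)
    (Gp : forall u, u != 0 -> 0 < G u u) (s : seq V) :
  exists f : 'I_(size s) -> V,
    forall v, v \in s -> v = \sum_(k < size s) G v s`_k *: f k.
Proof.
have Gr u : linear_for *%R (G u) by move=> a v w; rewrite !(Gs u) Gl.
pose A : 'M[R]_(size s) := \matrix_(i, j) G s`_i s`_j.
have APA : A *m pinvmx A *m A = A by rewrite mulmxKpV.
exists (fun k => \sum_l pinvmx A k l *: s`_l) => v /(nthP 0)[i si <-].
pose i0 := Ordinal si; rewrite -[i]/(val i0).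
set w := \sum_k _.
have orth (j : 'I_(size s)) : G s`_j (s`_i0 - w) = 0.
  rewrite (linear_formB (Gr _)).
  have -> : G s`_j w = A i0 j.
    rewrite -{1}APA !mxE /w linear_form_sum//.
    under [RHS]eq_bigr => l _ do rewrite mxE big_distrl.
    rewrite exchange_big/=; apply: eq_bigr => k _.
    rewrite linear_form_sum// big_distrr; apply: eq_bigr => l _ /=.
    by rewrite !mxE (Gs s`_j) mulrA.
  by rewrite mxE Gs subrr.
apply/eqP; rewrite -subr_eq0; apply/negP => /negP /Gp.
suff -> : G (s`_i0 - w) (s`_i0 - w) = 0 by rewrite ltxx.
rewrite (linear_formB (Gr _)) [G _ s`_i0]Gs orth sub0r /w linear_form_sum//.
rewrite big1 ?oppr0// => k _.
by rewrite linear_form_sum// big1 ?mulr0// => l _; rewrite Gs orth mulr0.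
Qed.

Lemma alt2_antisym (R : pzRingType) (V : lmodType R) (b : alt2 V) u v :
  b v u = - b u v.
Proof.
apply/eqP; rewrite -addr_eq0 addrC; apply/eqP; rewrite -[RHS](alt2_alt b (u + v)).
rewrite (linear_formD (alt2_linearl b _)) !(linear_formD (alt2_linearr b _)).
by rewrite !alt2_alt add0r addr0.
Qed.

Lemma alt2_ext (R : pzRingType) (V : lmodType R) (b c : alt2 V) :
  (forall u v, b u v = c u v) -> b = c.
Proof.
case: b c => [b bl br ba] [c cl cr ca] /= bc.
have {}bc : b = c by apply/funext => u; apply/funext => v; exact: bc.
by subst c; f_equal; exact: Prop_irrelevance.
Qed.

Lemma alt2_pullK (R : pzRingType) (V : lmodType R) (phi chi : {linear V -> V}) :
  cancel phi chi -> cancel (alt2_pull chi) (alt2_pull phi).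
Proof. by move=> phiK b; apply: alt2_ext => u v /=; rewrite !phiK. Qed.

(** An alternating form only sees the antisymmetric part of the coefficient
matrix, and that part is the 2-form written in the frame: this is how
\sum_i b (v_i, w_i) becomes a function of \sum_i a_i /\ b_i alone. *)
Lemma alt2_frame (R : realFieldType) (V : lmodType R) (b : alt2 V)
    (K I : finType) (c d : I -> K -> R) (f : K -> V) :
  \sum_i b (\sum_k c i k *: f k) (\sum_k d i k *: f k)
  = (\sum_k \sum_l (\sum_i (c i k * d i l - c i l * d i k)) * b (f k) (f l)) / 2.
Proof.
have bE i : b (\sum_k c i k *: f k) (\sum_k d i k *: f k)
    = \sum_k \sum_l c i k * d i l * b (f k) (f l).
  rewrite (linear_form_sum _ _ (alt2_linearl b _)); apply: eq_bigr => k _.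
  rewrite (linear_form_sum _ _ (alt2_linearr b _)) big_distrr.
  by apply: eq_bigr => l _; rewrite /= mulrA.
under eq_bigr => i _ do rewrite bE.
pose S := \sum_k \sum_l (\sum_i c i k * d i l) * b (f k) (f l).
have -> : \sum_i \sum_k \sum_l c i k * d i l * b (f k) (f l) = S.
  rewrite exchange_big; apply: eq_bigr => k _.
  by rewrite exchange_big; apply: eq_bigr => l _; rewrite big_distrl.
suff -> : \sum_k \sum_l (\sum_i (c i k * d i l - c i l * d i k)) * b (f k) (f l) = S + S.
  by lra.
transitivity (S - \sum_k \sum_l (\sum_i c i l * d i k) * b (f k) (f l)).
  rewrite -sumrB; apply: eq_bigr => k _; rewrite -sumrB; apply: eq_bigr => l _.
  by rewrite -mulrBl sumrB.
congr (_ + _); rewrite exchange_big -sumrN; apply: eq_bigr => k _ /=.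
by rewrite -sumrN; apply: eq_bigr => l _; rewrite alt2_antisym mulrN opprK.
Qed.

(** * The sharp of a 2-form *)

Section Geometry.
Variables (R : realType) (n : nat) (M : manifold R n).

(** The set from which [sharp2] chooses. *)
Definition sharp2_spec (g : metric M) (p : M) (gamma : alt2 (tangent p)) :
    set (alt2 (tangent p) -> R) :=
  [set u | exists k (a b : 'I_k -> {scalar tangent p})
                  (v w : 'I_k -> tangent p),
    [/\ forall i, is_sharp g (a i) (v i) /\ is_sharp g (b i) (w i),
        forall x y, gamma x y = \sum_(i < k) cowedge (a i) (b i) x y &
        u = \sum_(i < k) wedge (v i) (w i)]].

Lemma sum_wedgeE (p : M) (I : finType) (v w : I -> tangent p) (b : alt2 (tangent p)) :
  (\sum_i wedge (v i) (w i)) b = \sum_i b (v i) (w i).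
Proof. by rewrite fct_sumE. Qed.

(** A decomposition of gamma with sharps v_i, w_i sends the alternating form c to
\sum_i c (v_i, w_i). Expanding in one reproducing frame f_k for the vectors s_k
of both decompositions, this is half of
\sum_kl gamma (s_k, s_l) * c (f_k, f_l), whatever the decomposition. *)
Lemma sharp2_spec_uniq (g : metric M) (p : M) (gamma : alt2 (tangent p)) u u' :
  sharp2_spec g gamma u -> sharp2_spec g gamma u' -> u = u'.
Proof.
move=> [k [a [b [v [w [vw gammaE ->]]]]]].
move=> [k' [a' [b' [v' [w' [vw' gammaE' ->]]]]]].
apply/funext => c; rewrite !sum_wedgeE.
pose s := (codom v ++ codom w) ++ (codom v' ++ codom w').
have [f fE] := dual_frame (@Defs.metric_linear _ _ _ g p)
  (@Defs.metric_sym _ _ _ g p) (@Defs.metric_pos _ _ _ g p) s.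
have main m (a1 b1 : 'I_m -> {scalar tangent p}) (v1 w1 : 'I_m -> tangent p) :
    (forall i, is_sharp g (a1 i) (v1 i) /\ is_sharp g (b1 i) (w1 i)) ->
    (forall x y, gamma x y = \sum_(i < m) cowedge (a1 i) (b1 i) x y) ->
    {subset codom v1 <= s} -> {subset codom w1 <= s} ->
    \sum_i c (v1 i) (w1 i)
    = (\sum_(k < size s) \sum_(l < size s) gamma s`_k s`_l * c (f k) (f l)) / 2.
  move=> vw1 gE vs ws.
  transitivity (\sum_i c (\sum_(k < size s) g p (v1 i) s`_k *: f k)
                         (\sum_(k < size s) g p (w1 i) s`_k *: f k)).
    by apply: eq_bigr => i _; rewrite -!fE //; [apply: ws|apply: vs]; exact: codom_f.
  rewrite alt2_frame; congr (_ / _).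
  apply: eq_bigr => j _; apply: eq_bigr => l _; congr (_ * _).
  rewrite gE; apply: eq_bigr => i _; have [av bw] := vw1 i.
  by rewrite /cowedge -!av -!bw.
rewrite (main k a b)// ?(main k' a' b')//.
all: by move=> z zin; rewrite !mem_cat zin ?orbT.
Qed.

Variables (g : metric M) (psi : bundle_aut M).
Let h := pull_metric g psi.

Lemma is_sharp_pull (p : M) (a : {scalar tangent p}) v :
  is_sharp h a v -> is_sharp g (a \o psi p) (aut_inv psi p v).
Proof. by move=> av w; rewrite /= -av /= aut_mapK. Qed.

Lemma is_sharp_push (p : M) (a : {scalar tangent p}) v :
  is_sharp g a v -> is_sharp h (a \o aut_inv psi p) (psi p v).
Proof. by move=> av w; rewrite /= -av aut_mapK. Qed.

Lemma sharp2_spec_pull (p : M) (gamma : alt2 (tangent p)) u :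
  sharp2_spec h gamma u ->
  sharp2_spec g (alt2_pull (psi p) gamma) (u \o alt2_pull (aut_inv psi p)).
Proof.
move=> [k [a [b [v [w [vw gammaE ->]]]]]].
exists k, (fun i => a i \o psi p), (fun i => b i \o psi p),
  (fun i => aut_inv psi p (v i)), (fun i => aut_inv psi p (w i)); split.
- by move=> i; have [av bw] := vw i; split; exact: is_sharp_pull.
- by move=> x y; rewrite /= gammaE.
- by apply/funext => c; rewrite /= !sum_wedgeE.
Qed.

Lemma sharp2_spec_push (p : M) (gamma : alt2 (tangent p)) u :
  sharp2_spec g (alt2_pull (psi p) gamma) u ->
  sharp2_spec h gamma (u \o alt2_pull (psi p)).
Proof.
move=> [k [a [b [v [w [vw gammaE ->]]]]]].
exists k, (fun i => a i \o aut_inv psi p), (fun i => b i \o aut_inv psi p),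
  (fun i => psi p (v i)), (fun i => psi p (w i)); split.
- by move=> i; have [av bw] := vw i; split; exact: is_sharp_push.
- move=> x y; rewrite -[x in LHS](aut_invK psi) -[y in LHS](aut_invK psi).
  exact: gammaE.
- by apply/funext => c; rewrite /= !sum_wedgeE.
Qed.

(** When gamma has no decomposition with sharps for h, its pullback has none for
g either: hence the converse transport [sharp2_spec_push], after which both
sides take the default value 0. *)
Lemma sharp2_pull (p : M) (gamma : alt2 (tangent p)) :
  sharp2 g (alt2_pull (psi p) gamma)
  = sharp2 h gamma \o alt2_pull (aut_inv psi p).
Proof.
rewrite /sharp2 -!/(sharp2_spec _ _).
have [[u hu]|no] := pselect (exists u, sharp2_spec h gamma u).
  rewrite (xget_subset1 _ hu (@sharp2_spec_uniq _ _ _)).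
  by rewrite (xget_subset1 _ (sharp2_spec_pull hu) (@sharp2_spec_uniq _ _ _)).
rewrite !xgetPN// => u gu; apply: no.
  by exists u.
by exists (u \o alt2_pull (psi p)); exact: sharp2_spec_push.
Qed.

(** * The Levi-Civita connection of the pulled back metric *)

Lemma vfield_ext (X Y : vfield M) : (forall p, vf_at X p = vf_at Y p) -> X = Y.
Proof.
move=> XY; apply/val_inj/funext => f; apply/val_inj/funext => p.
exact: (congr1 (fun v : tangent p => v f : R) (XY p)).
Qed.

Lemma vf_atD (X Y : vfield M) p : vf_at (X + Y) p = vf_at X p + vf_at Y p.
Proof. by apply/val_inj/funext. Qed.

Lemma vf_atB (X Y : vfield M) p : vf_at (X - Y) p = vf_at X p - vf_at Y p.
Proof. by apply/val_inj/funext. Qed.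

Lemma vf_atZ (f : smoothFun M) (X : vfield M) p :
  vf_at (f *: X) p = f p *: vf_at X p.
Proof. by apply/val_inj/funext. Qed.

Lemma bm_vfD (phi : bundle_map M) X Y : bm_vf phi (X + Y) = bm_vf phi X + bm_vf phi Y.
Proof. by apply: vfield_ext => p; rewrite vf_atD !bm_vf_at vf_atD linearD. Qed.

Lemma bm_vfB (phi : bundle_map M) X Y : bm_vf phi (X - Y) = bm_vf phi X - bm_vf phi Y.
Proof. by apply: vfield_ext => p; rewrite vf_atB !bm_vf_at vf_atB linearB. Qed.

Lemma bm_vfZ (phi : bundle_map M) f X : bm_vf phi (f *: X) = f *: bm_vf phi X.
Proof. by apply: vfield_ext => p; rewrite vf_atZ !bm_vf_at vf_atZ linearZ. Qed.

Lemma aut_vfK X : bm_vf (aut_inv psi) (bm_vf psi X) = X.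
Proof. by apply: vfield_ext => p; rewrite !bm_vf_at aut_mapK. Qed.

Lemma aut_vfVK X : bm_vf psi (bm_vf (aut_inv psi) X) = X.
Proof. by apply: vfield_ext => p; rewrite !bm_vf_at aut_invK. Qed.

Lemma pull_metric_vf X Y :
  metric_vf h X Y = metric_vf g (bm_vf (aut_inv psi) X) (bm_vf (aut_inv psi) Y).
Proof. by apply/val_inj/funext => p /=; rewrite !bm_vf_at. Qed.

Lemma metric_vfBl (m : metric M) X Y Z :
  metric_vf m (X - Y) Z = metric_vf m X Z - metric_vf m Y Z.
Proof.
apply/val_inj/funext => p /=; rewrite vf_atB.
exact: linear_formB (@Defs.metric_linear _ _ _ m p _) _ _.
Qed.

Lemma metric_vfC (m : metric M) X Y : metric_vf m X Y = metric_vf m Y X.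
Proof. by apply/val_inj/funext => p /=; exact: Defs.metric_sym. Qed.

Lemma metric_vf_eq0 (m : metric M) X : metric_vf m X X = 0 -> X = 0.
Proof.
move=> mX; apply: vfield_ext => p.
have -> : vf_at (0 : vfield M) p = 0 by apply/val_inj/funext.
apply/eqP; apply/negP => /negP /(Defs.metric_pos m).
have -> : m p (vf_at X p) (vf_at X p) = 0.
  by have /(congr1 (fun f : smoothFun M => f p)) := mX.
by rewrite ltxx.
Qed.

Lemma subr_eq_exchange (V : zmodType) (a b c d : V) :
  a - b = c - d -> a - c = b - d.
Proof.
by move/eqP; rewrite subr_eq => /eqP ->; rewrite addrAC [c - d]addrC addrK addrC.
Qed.

(** The difference of the two connections, lowered to t X Y Z, is symmetric in
X, Y as neither has torsion and antisymmetric in Y, Z as both preserve the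
metric; such a t vanishes. Positivity applied to Z := the difference itself
concludes, so no vector field has to be extended from a point. *)
Lemma levi_civita_uniq (m : metric M) (nab nab' : connection M) :
  is_levi_civita m nab -> is_levi_civita m nab' -> nab = nab'.
Proof.
move=> lc lc'; pose t X Y Z := metric_vf m (nab X Y - nab' X Y) Z.
have symt X Y Z : t X Y Z = t Y X Z.
  rewrite /t; congr metric_vf.
  apply: subr_eq_exchange.
  exact: etrans (lc_torsion lc X Y) (esym (lc_torsion lc' X Y)).
have altt X Y Z : t X Z Y = - t X Y Z.
  apply/eqP; rewrite -addr_eq0 /t !metric_vfBl.
  have e := etrans (esym (lc_metric lc X Y Z)) (lc_metric lc' X Y Z).
  rewrite (metric_vfC m (nab X Z)) (metric_vfC m (nab' X Z)) addrACA -opprD.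
  by rewrite subr_eq0 addrC e addrC.
have t0 X Y Z : t X Y Z = 0.
  have : t X Y Z = - t X Y Z.
    rewrite {1}(altt X Z Y) (symt X Z) (altt Z Y X) opprK (symt Z Y) (altt Y X Z).
    by rewrite (symt Y X).
  move=> tN; apply/val_inj/funext => p.
  have tNp : t X Y Z p = - (t X Y Z p).
    exact: (congr1 (fun f : smoothFun M => f p : R) tN).
  by suff : t X Y Z p = 0; [|lra].
apply/funext => X; apply/funext => Y; apply/eqP; rewrite -subr_eq0; apply/eqP.
exact: metric_vf_eq0 (t0 X Y _).
Qed.

Definition conj_connection (nab : connection M) : connection M :=
  fun X Y => bm_vf psi (nab X (bm_vf (aut_inv psi) Y)).

(** The Codazzi equation, after applying psi, is exactly the statement that the
torsion of the conjugated connection is that of the original one. *)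
Lemma levi_civita_conj (nab : connection M) :
  is_levi_civita g nab -> is_codazzi nab psi ->
  is_levi_civita h (conj_connection nab).
Proof.
move=> lc cod; split.
- by move=> f X Y Z; rewrite /conj_connection (lc_linearl lc) bm_vfD bm_vfZ.
- by move=> X Y Z; rewrite /conj_connection bm_vfD (lc_addr lc) bm_vfD.
- move=> f X Y.
  by rewrite /conj_connection bm_vfZ (lc_leibniz lc) bm_vfD !bm_vfZ aut_vfVK.
- by move=> X Y Z; rewrite !pull_metric_vf (lc_metric lc) !aut_vfK.
- move=> X Y; rewrite -(lc_torsion lc).
  have := congr1 (bm_vf psi) (cod X Y).
  by rewrite /nab_bm !bm_vfB !aut_vfVK => /subr_eq_exchange.
Qed.

(** * Curvature *)

Lemma Rm_conj (nab : connection M) X Y Z W :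
  Rm h (conj_connection nab) X Y Z W
  = Rm g nab X Y (bm_vf (aut_inv psi) Z) (bm_vf (aut_inv psi) W).
Proof.
rewrite /Rm pull_metric_vf /curvature /conj_connection !bm_vfB.
by rewrite !aut_vfK.
Qed.

(** The isomorphism psi exchanges the decompositions of v and of its image under
psi^-1 while keeping the value of the double sum, so that both choices are made
from the same set of real numbers. *)
Lemma Rm2_conj (nab : connection M) (p : M) (u v : alt2 (tangent p) -> R) :
  Rm2 h (conj_connection nab) u v = Rm2 g nab u (v \o alt2_pull (aut_inv psi p)).
Proof.
rewrite /Rm2; congr xget; apply/seteqP; split=> r [k [l [X [Y [Z [W [uE vE ->]]]]]]].
  exists k, l, X, Y, (fun j => bm_vf (aut_inv psi) (Z j)),
    (fun j => bm_vf (aut_inv psi) (W j)); split => //.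
    apply/funext => c; rewrite /= vE !sum_wedgeE; apply: eq_bigr => j _.
    by rewrite !bm_vf_at.
  by apply: eq_bigr => i _; apply: eq_bigr => j _; rewrite Rm_conj.
exists k, l, X, Y, (fun j => bm_vf psi (Z j)), (fun j => bm_vf psi (W j)); split => //.
  apply/funext => c; rewrite -[c in LHS](alt2_pullK (aut_invK psi (p:=p))).
  move/(congr1 (fun s => s (alt2_pull (psi p) c))): vE.
  rewrite /= => ->; rewrite !sum_wedgeE; apply: eq_bigr => j _ /=.
  by rewrite !bm_vf_at.
by apply: eq_bigr => i _; apply: eq_bigr => j _; rewrite Rm_conj !aut_vfK.
Qed.

End Geometry.

Theorem proposition2p6 (R : realType) (n : nat) (M : manifold R n)
    (g : metric M) (psi : bundle_aut M) (nabg nabh : connection M) :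
  is_levi_civita g nabg ->
  is_codazzi nabg psi ->
  is_levi_civita (pull_metric g psi) nabh ->
  forall (p : M) (gamma : alt2 (tangent p)),
    curvature_operator (pull_metric g psi) nabh gamma
    = curvature_operator g nabg (alt2_pull (psi p) gamma).
Proof.
move=> lcg cod lch p gamma; apply/funext => x; apply/funext => y.
rewrite (levi_civita_uniq lch (levi_civita_conj lcg cod)).
by rewrite /curvature_operator Rm2_conj sharp2_pull.
Qed.
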